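(* Let $q>1$ be an odd integer and let $x$ be any element of $G^\ast_q$. Then $\xi(q,\overline{x})$ is the smallest positive integer $r$ such that $q\mid 2^{r}-1$.
   Context: Let $q>1$ be an odd integer. Let $G^\ast_q$ be the set of all positive odd integers less than $q$ that are coprime to $q$. Cycles: for $a_1\in G^\ast_q$, define successively $a_{i+1}=\frac{q+a_i}{2^{k_i}}$, where $k_i\ge 1$ is the integer for which $a_{i+1}$ is odd, until the first $n\geq 1$ with $a_{n+1}=a_1$. This gives a cycle $(a_1,a_2,\dots,a_n)$ of elements of $G^\ast_q$, and $\overline{a_1}$ denotes the set $\{a_1,a_2,\dots,a_n\}$. For an even positive integer $n$, $\tau(n)$ denotes the exponent of the prime $2$ in the factorization of $n$. For $x\in G^\ast_q$, put $\xi(q,\overline{x})=\sum_{m\in\overline{x}}\tau(q+m)$. *)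

(* Defs.v *)
From mathcomp Require Import all_boot.
From mathcomp Require Import zify.

Set Implicit Arguments.
Unset Strict Implicit.
Unset Printing Implicit Defensive.

(* Positivity is implied by oddness. *)
Definition Gstar (q : nat) : pred nat :=
  [pred a | [&& odd a, a < q & coprime a q]].

Definition tau (n : nat) : nat := logn 2 n.

Definition cstep (q a : nat) : nat := (q + a) %/ 2 ^ tau (q + a).

(* The exponent used in [cstep] is the only one for which the quotient is an
   odd integer. *)
Lemma odd_quotient_tau n k :
  0 < n -> 2 ^ k %| n -> odd (n %/ 2 ^ k) = (k == tau n).
Proof.
move=> n_gt0 /dvdnP[m def_n]; rewrite /tau def_n mulnK ?expn_gt0 //.
have m_gt0: 0 < m by move: n_gt0; rewrite def_n muln_gt0 => /andP[].
rewrite lognM ?expn_gt0 // pfactorK // -{1}[k]add0n eqn_add2r eq_sym.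
by rewrite -[odd m]negbK -dvdn2 -[2]expn1 pfactor_dvdn // lt0n negbK.
Qed.

Lemma tau_gt0 q a : odd q -> a \in Gstar q -> 0 < tau (q + a).
Proof.
move=> oq /and3P[oa _ _]; rewrite /tau logn_gt0 mem_primes /=.
by rewrite dvdn2 oddD oq oa addn_gt0 odd_gt0.
Qed.

Lemma cstep_mul q a : cstep q a * 2 ^ tau (q + a) = q + a.
Proof. by rewrite divnK // pfactor_dvdnn. Qed.

Lemma cstep_Gstar q a : odd q -> a \in Gstar q -> cstep q a \in Gstar q.
Proof.
move=> oq aG; have k_gt0 := tau_gt0 oq aG; have E := cstep_mul q a.
case/and3P: aG => oa lt_aq co_aq; have q_gt0 := odd_gt0 oq.
apply/and3P; split.
- by rewrite odd_quotient_tau ?pfactor_dvdnn ?addn_gt0 ?q_gt0.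
- move: E k_gt0; case: (tau _) => // k; rewrite expnS => E _.
  have := expn_gt0 2 k => /=; nia.
- apply: (@coprime_dvdl _ (q + a)); first by rewrite -E dvdn_mulr.
  by rewrite /coprime gcdnC gcdnDl gcdnC.
Qed.

Lemma cstep_inj q : {in Gstar q &, injective (cstep q)}.
Proof.
move=> a b aG bG eq_ab.
wlog le_ab: a b aG bG eq_ab / tau (q + a) <= tau (q + b).
  by case/orP: (leq_total (tau (q + a)) (tau (q + b))) => le H;
     [apply: H | apply/esym/H].
have Ea := cstep_mul q a; have Eb := cstep_mul q b.
case/and3P: aG => oa lt_aq _; case/and3P: bG => _ lt_bq _.
move: Eb; rewrite -eq_ab -(subnKC le_ab) expnD mulnA Ea.
case: (_ - _) => [|d]; first by rewrite muln1 => /addnI.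
rewrite expnS; have := expn_gt0 2 d => /=; have := odd_gt0 oa; nia.
Qed.

Lemma cycle_returns q a : odd q -> a \in Gstar q ->
  exists n, (0 < n) && (iter n (cstep q) a == a).
Proof.
move=> oq aG; pose T := {i : 'I_q | val i \in Gstar q}.
have lt_q b : b \in Gstar q -> b < q by case/and3P.
pose mk b (bG : b \in Gstar q) : T :=
  @Sub _ (fun i : 'I_q => val i \in Gstar q) T (Ordinal (lt_q b bG)) bG.
pose f (u : T) : T := mk _ (cstep_Gstar oq (valP u)).
have f_inj: injective f.
  move=> u v /(congr1 (fun w : T => val (val w))) /= eq_uv.
  by apply/val_inj/val_inj/(cstep_inj (valP u) (valP v)).
exists (order f (mk a aG)); rewrite order_gt0 /=.
have val_iter n : val (val (iter n f (mk a aG))) = iter n (cstep q) a.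
  by elim: n => //= n ->.
by rewrite -val_iter iter_order.
Qed.

(* [ex_minn] returns the least witness, that is, the first n >= 1 at which the
   sequence a, cstep q a, cstep q (cstep q a), etc. comes back to a. *)
Definition cycle_length (q a : nat) (oq : odd q) (aG : a \in Gstar q) : nat :=
  ex_minn (cycle_returns oq aG).

Definition cycle_of (q a : nat) (oq : odd q) (aG : a \in Gstar q) : seq nat :=
  traject (cstep q) a (cycle_length oq aG).

(* [undup]: the sum ranges over the set of the elements of the cycle. *)
Definition xi (q x : nat) (oq : odd q) (xG : x \in Gstar q) : nat :=
  \sum_(m <- undup (cycle_of oq xG)) tau (q + m).

(* Main.v *)
Require Import Defs.
From mathcomp Require Import all_boot.

(** Modulo [q], one step of the cycle is division by a power of two:
    [cstep q a * 2 ^ tau (q + a) = q + a].  A walk of [j] steps from [a] to [b]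
    therefore yields [b * 2 ^ w = a] modulo [q], where [w] is the total of the
    exponents met on the way ([iter_cstep_walk_weight]).  A full turn around
    the cycle of [x] has weight [xi], so [x * 2 ^ xi = x], and the unit [x]
    cancels: [q] divides [2 ^ xi - 1].

    Minimality comes from the converse ([walk_of_congruence]): each congruence
    [b * 2 ^ r = a] modulo [q] between elements of [Gstar q] is realized by a
    walk from [a] to [b] of weight exactly [r].  If [q] divides [2 ^ r - 1] with
    [r > 0], then [x * 2 ^ r = x], so [r] is the weight of a nonempty closed
    walk at [x]; such a walk is at least as long as the cycle, hence at least
    as heavy. *)

Definition walk_weight (q a j : nat) : nat :=
  \sum_(m <- traject (cstep q) a j) tau (q + m).

Lemma walk_weightS q a j :
  walk_weight q a j.+1 = tau (q + a) + walk_weight q (cstep q a) j.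
Proof. by rewrite /walk_weight trajectS big_cons. Qed.

Lemma leq_walk_weight q a i j :
  i <= j -> walk_weight q a i <= walk_weight q a j.
Proof.
by move=> /subnKC <-; rewrite /walk_weight trajectD big_cat leq_addr.
Qed.

Lemma iter_cstep_walk_weight q a j :
  iter j (cstep q) a * 2 ^ walk_weight q a j = a %[mod q].
Proof.
elim: j a => [|j IHj] a; first by rewrite /walk_weight big_nil muln1.
rewrite iterSr walk_weightS addnC expnD mulnA -modnMml IHj modnMml.
by rewrite cstep_mul modnDl.
Qed.

Lemma eqn_modMpow2r q n a b : odd q ->
  (a * 2 ^ n == b * 2 ^ n %[mod q]) = (a == b %[mod q]).
Proof.
move=> oq; have co_q2n: coprime q (2 ^ n) by rewrite coprimeXr // coprimen2.
wlog le_ba: a b / b <= a.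
  by case/orP: (leq_total b a) => le H; [|rewrite eq_sym [RHS]eq_sym]; apply: H.
by rewrite !eqn_mod_dvd ?leq_mul // -mulnBl Gauss_dvdl.
Qed.

Lemma eqn_mod_dvd_pow2 q x r : coprime x q ->
  (x * 2 ^ r == x %[mod q]) = (q %| 2 ^ r - 1).
Proof.
move=> co_xq; rewrite eqn_mod_dvd ?leq_pmulr ?expn_gt0 //.
by rewrite -{2}[x]muln1 -mulnBr Gauss_dvdr // coprime_sym.
Qed.

(** Strong induction on [r] peels off steps from [a] as long as
    [k := tau (q + a)] does not exceed [r].  The walk cannot stop inside a step:
    if [0 < r < k], then [b] would be congruent to [(q + a) / 2 ^ r], which is
    below [q] because [r > 0] and even because [r < k], whereas [b] is odd. *)
Lemma walk_of_congruence q a b r : odd q -> a \in Gstar q -> b \in Gstar q ->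
  b * 2 ^ r = a %[mod q] ->
  exists j, iter j (cstep q) a = b /\ walk_weight q a j = r.
Proof.
move=> oq; elim/ltn_ind: r a => r IHr a aG bG eq_ba.
have /and3P[_ lt_aq _] := aG; have /and3P[ob lt_bq _] := bG.
have k_gt0 := tau_gt0 oq aG; have E := cstep_mul q a.
have sG := cstep_Gstar oq aG.
have [r0 | r_gt0] := posnP r.
  exists 0; rewrite /walk_weight big_nil r0; split=> //=.
  by move: eq_ba; rewrite r0 muln1 !modn_small.
have [le_kr | lt_rk] := leqP (tau (q + a)) r.
  have eq_bs: b * 2 ^ (r - tau (q + a)) = cstep q a %[mod q].
    apply/eqP; rewrite -(eqn_modMpow2r _ (tau (q + a))) // -mulnA -expnD.
    by rewrite subnK // E modnDl eq_ba.
  have lt_r: r - tau (q + a) < r by rewrite ltn_subrL k_gt0.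
  have [j [Ej Wj]] := IHr _ lt_r _ sG bG eq_bs.
  by exists j.+1; rewrite iterSr walk_weightS Wj subnKC.
have d_gt0: 0 < tau (q + a) - r by rewrite subn_gt0.
pose c := cstep q a * 2 ^ (tau (q + a) - r).
have Ec: c * 2 ^ r = q + a by rewrite -mulnA -expnD subnK // ltnW.
have lt_cq: c < q.
  rewrite -(@ltn_pmul2r (2 ^ r)) ?expn_gt0 // Ec.
  apply: (@leq_trans (q * 2)); first by rewrite muln2 -addnn ltn_add2l.
  by rewrite leq_mul2l (@leq_exp2l 2 1) // r_gt0 orbT.
have eq_bc: b = c.
  have: b == c %[mod q] by rewrite -(eqn_modMpow2r _ r) // Ec modnDl eq_ba.
  by rewrite !modn_small // => /eqP.
by move: ob; rewrite eq_bc oddM oddX (gtn_eqF d_gt0) andbF.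
Qed.

(** A repetition could be shifted forward to the end of the cycle, which would
    make the sequence return to [a] too early. *)
Lemma uniq_cycle_of q a (oq : odd q) (aG : a \in Gstar q) :
  uniq (cycle_of oq aG).
Proof.
rewrite /cycle_of /cycle_length; case: ex_minnP => n /andP[n_gt0 /eqP En] minn.
case: n n_gt0 En minn => // n _ En minn.
rewrite looping_uniq; apply/negP => /trajectP[i lt_in eq_in].
suff: n < i.+1 by rewrite ltnS leqNgt lt_in.
by apply: minn; rewrite /= -eq_in -iterS En.
Qed.

Lemma xi_walk_weight q x (oq : odd q) (xG : x \in Gstar q) :
  xi oq xG = walk_weight q x (cycle_length oq xG).
Proof. by rewrite /xi undup_id ?uniq_cycle_of. Qed.

Theorem proposition2 (q x : nat) (q_gt1 : 1 < q) (oq : odd q)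
    (xG : x \in Gstar q) :
  [/\ 0 < xi oq xG,
      q %| 2 ^ xi oq xG - 1
    & forall r : nat, 0 < r -> q %| 2 ^ r - 1 -> xi oq xG <= r].
Proof.
have /and3P[_ _ co_xq] := xG; rewrite xi_walk_weight /cycle_length.
case: ex_minnP => n /andP[n_gt0 /eqP En] minn; split.
- by case: n n_gt0 {En minn} => // n _; rewrite walk_weightS ltn_addr ?tau_gt0.
- rewrite -(eqn_mod_dvd_pow2 _ x) //.
  by have /eqP := iter_cstep_walk_weight q x n; rewrite En.
move=> r r_gt0; rewrite -(eqn_mod_dvd_pow2 _ x) // => /eqP eq_r.
have [j [Ej Wj]] := walk_of_congruence _ _ _ _ oq xG xG eq_r.
rewrite -Wj leq_walk_weight // minn // Ej eqxx andbT lt0n.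
by apply: contraL r_gt0 => /eqP j0; rewrite -Wj j0 /walk_weight big_nil.
Qed.
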